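(* Let $X=\mathbb{R}^n$, $Y=\mathbb{R}^m$, $S=X\times Y$, $\mu^*\in P(S)$, $\varepsilon\ge0$, and let $\mathcal{G}=\mathrm{Lip}(Y;X)$ be the set of Lipschitz maps $G:Y\to X$, with $L_G$ denoting the Lipschitz constant of $G$. Let $\ell(x,y,G):=\|G(y)-x\|_2^2$ and $c((x,y),(u,v)):=\|(u,v)-(x,y)\|_2^2$, and for $(x,y)\in S$ let $$K_{(x,y)}=\{\delta_x\otimes\mu_{Y|X=x}\ :\ \mu_{Y|X}\in P(Y|X)\},$$ where $P(Y|X)$ denotes the set of Markov kernels $X\to P(Y)$. Then $$\inf_{G\in\mathcal{G}}I_{\Omega_{K,c,\varepsilon}}(G)\ \le\ \inf_{G\in\mathcal{G}}\left(\sqrt{\int_S\|G(y)-x\|_2^2\,d\mu^*(x,y)}+L_G\sqrt{\varepsilon}\right)^2.$$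
   Context: $P(S)$ is the set of Borel probability measures on $S$, $\delta_x$ is the Dirac measure at $x$, and $\|\cdot\|_2$ is the Euclidean norm. The notation $\pi_{S|S}:S\to K_s$ means a $\mu^*$-measurable kernel $s\mapsto\pi_{S|S=s}\in P(S)$ such that $\pi_{S|S=s}\in K_s$ for $\mu^*$-a.e. $s\in S$. Define $$\Omega_{K,c,\varepsilon}:=\Big\{\pi_{S|S}:S\to K_s\ :\ \int_S\int_S c(s,r)\,d\pi_{S|S=s}(r)\,d\mu^*(s)\le\varepsilon\Big\},$$ $$I_{\Omega_{K,c,\varepsilon}}(G):=\sup_{\pi_{S|S}\in\Omega_{K,c,\varepsilon}}\int_S\int_S\ell(r,G)\,d\pi_{S|S=s}(r)\,d\mu^*(s).$$ *)

(* Defs.v *)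
From HB Require Import structures.
From mathcomp Require Import all_boot all_order all_algebra.
From mathcomp Require Import all_classical all_reals all_analysis.

Set Implicit Arguments.
Unset Strict Implicit.
Unset Printing Implicit Defensive.

Import Order.TTheory GRing.Theory Num.Theory.
Import numFieldNormedType.Exports.

Local Open Scope classical_set_scope.
Local Open Scope ring_scope.

(* Borel sigma-algebra: the topology of the library on matrices is that of the
   sup norm, which is the usual topology of R^(m * n). The product
   sigma-algebra on 'rV[R]_n * 'rV[R]_m is then the Borel sigma-algebra of the
   product, both factors being second countable. *)
HB.instance Definition _ (R : realType) (m n : nat) :=
  @isMeasurable.Build (sigma_display (@open 'M[R]_(m, n))) 'M[R]_(m, n)
    <<s (@open 'M[R]_(m, n)) >>
    (@sigma_algebra0 _ setT (@open 'M[R]_(m, n)))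
    (@sigma_algebraC _ (@open 'M[R]_(m, n)))
    (@sigma_algebra_bigcup _ setT (@open 'M[R]_(m, n))).

(* The library's norm on matrices is the sup norm; this is the Euclidean one. *)
Definition enorm (R : realType) (n : nat) (v : 'rV[R]_n) : R :=
  Num.sqrt (\sum_(i < n) v ord0 i ^+ 2).

Definition lip_bounds (R : realType) (m n : nat) (G : 'rV[R]_m -> 'rV[R]_n) :
    set R :=
  [set L | 0 <= L /\ forall y z, enorm (G y - G z) <= L * enorm (y - z)].

Definition Lip (R : realType) (m n : nat) : set ('rV[R]_m -> 'rV[R]_n) :=
  [set G | lip_bounds G !=set0].

Definition lip_const (R : realType) (m n : nat) (G : 'rV[R]_m -> 'rV[R]_n) : R :=
  inf (lip_bounds G).

(* T equipped with the completion of its sigma-algebra with respect to mu; for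
   a sigma-finite mu (here, a probability) this is the sigma-algebra of the
   Caratheodory-measurable sets, on which the library defines the completed
   measure completed_measure_extension mu. *)
Definition completion (d : measure_display) (T : measurableType d)
    (R : realType) (mu : {measure set T -> \bar R}) : measurableType _ :=
  caratheodory_type (mu^*)%mu.

Definition completed (d : measure_display) (T : measurableType d)
    (R : realType) (mu : {measure set T -> \bar R}) :
    {measure set (completion mu) -> \bar R} :=
  @completed_measure_extension d T R mu.

(* mu-measurable kernels into P(T) are kernels out of the completion. *)
Definition Omega (d : measure_display) (T : measurableType d) (R : realType)
    (mu : {measure set T -> \bar R}) (K : T -> set {measure set T -> \bar R})
    (c : T -> T -> R) (eps : R) : set (R.-pker (completion mu) ~> T) :=
  [set k | {ae completed mu, forall s, K s (k s)} /\
     (\int[completed mu]_s \int[k s]_r (c s r)%:E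
        <= eps%:E)%E].
Arguments Omega {d T R} mu K c eps _.

Definition I_Omega (d : measure_display) (T : measurableType d) (R : realType)
    (mu : {measure set T -> \bar R}) (K : T -> set {measure set T -> \bar R})
    (c : T -> T -> R) (eps : R) (GT : Type) (ell : T -> GT -> R) (G : GT) :
    \bar R :=
  ereal_sup [set (\int[completed mu]_s
                    \int[k s]_r (ell r G)%:E)%E
            | k in Omega mu K c eps].

Definition ell (R : realType) (n m : nat) (s : 'rV[R]_n * 'rV[R]_m)
    (G : 'rV[R]_m -> 'rV[R]_n) : R :=
  enorm (G s.2 - s.1) ^+ 2.

(* row_mx identifies R^n * R^m with R^(n + m). *)
Definition cost (R : realType) (n m : nat) (s r : 'rV[R]_n * 'rV[R]_m) : R :=
  enorm (row_mx r.1 r.2 - row_mx s.1 s.2) ^+ 2.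

(* Measures are compared on measurable sets only. *)
Definition K_dirac (R : realType) (n m : nat) (s : 'rV[R]_n * 'rV[R]_m) :
    set {measure set ('rV[R]_n * 'rV[R]_m) -> \bar R} :=
  [set P | exists nu : R.-pker 'rV[R]_n ~> 'rV[R]_m,
     forall A : set ('rV[R]_n * 'rV[R]_m), measurable A ->
       P A = (\d_(s.1) \x nu s.1)%E A].

(* Main.v *)
(** The inequality holds for each Lipschitz map G separately, with L its
    Lipschitz constant. If k is in Omega, then k s is concentrated on
    { r | r.1 = s.1 }, where
      G r.2 - r.1 = (G s.2 - s.1) + (G r.2 - G s.2),
    so that for every t > 0
      ell r G <= (1 + t) ell s G + (1 + 1/t) L^2 c(s, r).
    Integrating gives (1 + t) A + (1 + 1/t) L^2 eps, where A is the integral of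
    ell; optimising over t yields (sqrt A + L sqrt eps)^2. The parameter t
    replaces Minkowski's inequality for the joint law of s and r. *)

Require Import Defs.
From HB Require Import structures.
From mathcomp Require Import all_boot all_order all_algebra.
From mathcomp Require Import all_classical all_reals all_analysis.
From mathcomp Require Import measurable_realfun ring lra.
Set Implicit Arguments.
Unset Strict Implicit.
Unset Printing Implicit Defensive.

Import Order.TTheory GRing.Theory Num.Theory.
Import numFieldNormedType.Exports.
Local Open Scope classical_set_scope.
Local Open Scope ring_scope.

(** * The Euclidean norm on row vectors *)

Lemma enorm_sqr (R : realType) (n : nat) (v : 'rV[R]_n) :
  enorm v ^+ 2 = \sum_(i < n) v ord0 i ^+ 2.
Proof. by rewrite sqr_sqrtr// sumr_ge0// => i _; exact: sqr_ge0. Qed.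

Lemma enorm_ge0 (R : realType) (n : nat) (v : 'rV[R]_n) : 0 <= enorm v.
Proof. exact: sqrtr_ge0. Qed.

(** Coordinatewise, the right side minus the left side is the square $(tx-y)^2/t$. *)
Lemma enormD_sqr_le (R : realType) (n : nat) (t : R) (u v : 'rV[R]_n) : 0 < t ->
  enorm (u + v) ^+ 2 <= (1 + t) * enorm u ^+ 2 + (1 + t^-1) * enorm v ^+ 2.
Proof.
move=> t0; rewrite !enorm_sqr !mulr_sumr -big_split /=.
apply: ler_sum => i _; rewrite mxE; set x := u _ _; set y := v _ _.
rewrite -subr_ge0 (_ : _ - _ = (t * x - y) ^+ 2 / t); last first.
  by field; rewrite gt_eqF.
by rewrite divr_ge0 ?sqr_ge0// ltW.
Qed.

Lemma coord_le_enorm (R : realType) (n : nat) (v : 'rV[R]_n) (i : 'I_n) :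
  `|v ord0 i| <= enorm v.
Proof.
rewrite -(@ler_pXn2r _ 2)// ?nnegrE ?enorm_ge0//.
rewrite real_normK ?num_real// enorm_sqr (bigD1 i)//= lerDl sumr_ge0// => j _.
exact: sqr_ge0.
Qed.

(** Each of the $n$ squared coordinates is at most the squared sup norm. This links Euclidean
    Lipschitz bounds to the topology, which comes from the sup norm. *)
Lemma enorm_le_norm (R : realType) (n : nat) (v : 'rV[R]_n) :
  enorm v <= Num.sqrt n%:R * `|v|.
Proof.
rewrite -(@ler_pXn2r _ 2)// ?nnegrE ?mulr_ge0 ?enorm_ge0 ?sqrtr_ge0//.
rewrite enorm_sqr exprMn sqr_sqrtr// mulr_natl.
have -> : `|v| ^+ 2 *+ n = \sum_(i < n) `|v| ^+ 2 by rewrite sumr_const card_ord.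
apply: ler_sum => i _; rewrite -(real_normK (num_real (v ord0 i))).
by rewrite ler_pXn2r ?nnegrE// [leRHS]/Num.norm/= mx_normrE (le_bigmax _ _ (ord0, i)).
Qed.

(** * Lipschitz maps and their constant *)

Lemma lip_const_ge0 (R : realType) (m n : nat) (G : 'rV[R]_m -> 'rV[R]_n) :
  Lip G -> 0 <= lip_const G.
Proof. by move=> GL; apply: lb_le_inf => // L []. Qed.

(** The infimum defining [lip_const G] is attained: when [y] and [z] are at positive distance, the
    difference quotient is a lower bound of [lip_bounds G]. At distance zero every constant gives
    the same bound, so any admissible one will do. *)
Lemma lip_constP (R : realType) (m n : nat) (G : 'rV[R]_m -> 'rV[R]_n) y z :
  Lip G -> enorm (G y - G z) <= lip_const G * enorm (y - z).
Proof.
move=> GL; have [d0|dN0] := eqVneq (enorm (y - z)) 0.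
  by case: GL => L [_ /(_ y z)]; rewrite d0 !mulr0.
have d0 : 0 < enorm (y - z) by rewrite lt_neqAle eq_sym dN0 enorm_ge0.
rewrite -ler_pdivrMr//; apply: lb_le_inf => // L [_ LG].
by rewrite ler_pdivrMr.
Qed.

Lemma Lip_coord_continuous (R : realType) (m n : nat)
    (G : 'rV[R]_m -> 'rV[R]_n) (i : 'I_n) :
  Lip G -> continuous (fun y => G y ord0 i).
Proof.
move=> [L [L0 LG]] y.
apply/(@cvgrPdist_lt _ _ _ _ (nbhs_filter y)) => e e0.
(* The factor $\sqrt m$ passes from the Euclidean to the sup norm; the added 1 keeps [K] positive,
   hence invertible, even if [L] or [m] is 0. *)
pose K := L * Num.sqrt m%:R + 1.
have K0 : 0 < K by rewrite ltr_wpDl// mulr_ge0// sqrtr_ge0.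
have Gyz z : `|G y ord0 i - G z ord0 i| <= K * `|y - z|.
  have -> : G y ord0 i - G z ord0 i = (G y - G z) ord0 i by rewrite !mxE.
  apply: le_trans (coord_le_enorm _ _) _; apply: le_trans (LG _ _) _.
  apply: le_trans (ler_wpM2l L0 (enorm_le_norm _)) _.
  by rewrite mulrA ler_wpM2r// /K lerDl.
near=> z; rewrite (le_lt_trans (Gyz z))// mulrC -ltr_pdivlMr//; near: z.
have /cvgrPdist_lt := @cvg_id _ (nbhs y); apply; rewrite divr_gt0.
Unshelve. all: by end_near. Qed.

(** * Borel measurability on matrix spaces *)

Lemma continuous_measurable_mx (R : realType) (m n : nat) (f : 'M[R]_(m, n) -> R) :
  continuous f -> measurable_fun setT f.
Proof.
move=> /continuousP cf; apply: (measurability _ (RGenOpens.measurableE R)).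
move=> _ [_ [a [b ->] <-]]; rewrite setTI.
by apply: sub_sigma_algebra; apply: cf; exact: interval_open.
Qed.

Lemma measurable_coord (R : realType) (m n : nat) (i : 'I_m) (j : 'I_n) :
  measurable_fun setT (fun v : 'M[R]_(m, n) => v i j).
Proof. by apply: continuous_measurable_mx; exact: coord_continuous. Qed.

Lemma measurable_enorm_sqr (R : realType) d (T : measurableType d) (n : nat)
    (f : T -> 'rV[R]_n) :
  (forall i, measurable_fun setT (fun x => f x ord0 i)) ->
  measurable_fun setT (fun x => enorm (f x) ^+ 2).
Proof.
move=> mf; under eq_fun do rewrite enorm_sqr.
by apply: measurable_sum => i; exact: measurable_funX.
Qed.

Lemma measurable_ell (R : realType) (n m : nat) (G : 'rV[R]_m -> 'rV[R]_n) :
  Lip G -> measurable_fun setT (fun s => (ell s G)).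
Proof.
move=> GL; apply: measurable_enorm_sqr => i; under eq_fun do rewrite !mxE.
apply: measurable_funB.
  have mG : measurable_fun setT (fun y => G y ord0 i).
    by apply: continuous_measurable_mx; exact: Lip_coord_continuous.
  exact: (measurableT_comp mG measurable_snd).
exact: (measurableT_comp (measurable_coord _ _) measurable_fst).
Qed.

(** * Passing between [mu] and its completion *)

Lemma measurable_fun_id_completion d (T : measurableType d) (R : realType)
    (mu : {measure set T -> \bar R}) :
  measurable_fun setT (id : completion mu -> T).
Proof.
move=> _ A mA; rewrite setTI; apply: sub_caratheodory.
exact: sub_sigma_algebra.
Qed.

Lemma integral_completed d (T : measurableType d) (R : realType)
    (mu : {measure set T -> \bar R}) (f : T -> \bar R) :
  (forall x, 0 <= f x)%E -> measurable_fun setT f ->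
  (\int[completed mu]_x f x = \int[mu]_x f x)%E.
Proof.
move=> f0 mf.
have mid := @measurable_fun_id_completion d T R mu.
(* The pushforward of [completed mu] under the identity lives on the original sigma-algebra, where
   it agrees with [mu]. *)
rewrite -(ge0_integral_pushforward mid (completed mu) (D := setT))//.
apply: eq_measure_integral => A mA _.
exact: measurable_mu_extE.
Qed.

(** * The transport cost and the pointwise bound *)

Lemma costE (R : realType) (n m : nat) (s r : 'rV[R]_n * 'rV[R]_m) :
  cost s r = enorm (r.1 - s.1) ^+ 2 + enorm (r.2 - s.2) ^+ 2.
Proof.
rewrite /cost opp_row_mx add_row_mx !enorm_sqr big_split_ord/=.
by congr (_ + _); apply: eq_bigr => i _; rewrite ?row_mxEl ?row_mxEr.
Qed.

Lemma measurable_cost (R : realType) (n m : nat) d (T : measurableType d)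
    (f g : T -> 'rV[R]_n * 'rV[R]_m) :
  measurable_fun setT f -> measurable_fun setT g ->
  measurable_fun setT (fun x => cost (f x) (g x)).
Proof.
move=> mf mg; under eq_fun do rewrite costE.
apply: measurable_funD; apply: measurable_enorm_sqr => i;
  under eq_fun do rewrite !mxE; apply: measurable_funB;
  apply: (measurableT_comp (measurable_coord _ _));
  solve [exact: (measurableT_comp measurable_fst)
        |exact: (measurableT_comp measurable_snd)].
Qed.

Lemma K_dirac_ae (R : realType) (n m : nat) (s : 'rV[R]_n * 'rV[R]_m)
    (P : {measure set ('rV[R]_n * 'rV[R]_m) -> \bar R}) :
  K_dirac s P -> {ae P, forall r, r.1 = s.1}.
Proof.
move=> [nu PE].
have mN : measurable (~` [set s.1] : set 'rV[R]_n).
  apply: measurableC; rewrite -[X in measurable X]setCK; apply: measurableC.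
  apply: sub_sigma_algebra; apply: closed_openC.
  exact/accessible_closed_set1/hausdorff_accessible/norm_hausdorff.
exists (~` [set s.1] `*` setT); split => //.
- exact: measurableX.
- rewrite PE; last exact: measurableX.
  (* The sections of this cylinder are full or empty and [nu s.1] has mass one, so their measure is
     the indicator of the base, which has no mass under the Dirac measure at [s.1]. *)
  rewrite /product_measure1 (eq_integral (fun x => (\1_(~` [set s.1]) x)%:E)).
    by rewrite integral_indic// setIT//= diracE memNset// => /(_ erefl).
  move=> x _ /=; rewrite indicE; have [xs|xs] := boolP (x \in _).
    by rewrite in_xsectionX// prob_kernel.
  by rewrite notin_xsectionX// measure0.
Qed.

Lemma ell_le (R : realType) (n m : nat) (G : 'rV[R]_m -> 'rV[R]_n) (t : R)
    (s r : 'rV[R]_n * 'rV[R]_m) :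
  Lip G -> 0 < t -> r.1 = s.1 ->
  ell r G <= (1 + t) * ell s G + (1 + t^-1) * lip_const G ^+ 2 * cost s r.
Proof.
move=> GL t0 rs; rewrite /ell rs.
rewrite (_ : G r.2 - s.1 = (G s.2 - s.1) + (G r.2 - G s.2)); last first.
  by rewrite [RHS]addrC subrKA.
apply: le_trans (enormD_sqr_le _ _ t0) _; rewrite lerD2l -mulrA ler_wpM2l//.
  by rewrite addr_ge0// invr_ge0 ltW.
rewrite (@le_trans _ _ ((lip_const G * enorm (r.2 - s.2)) ^+ 2))//.
  by rewrite lerXn2r ?nnegrE ?mulr_ge0 ?enorm_ge0 ?lip_const_ge0 ?lip_constP.
by rewrite exprMn ler_wpM2l ?sqr_ge0// costE lerDr sqr_ge0.
Qed.

(** * Integrated bounds, first over [r], then over [s] *)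

Lemma ae_integral_le_lincomb d (T : measurableType d) (R : realType)
    (P : {measure set T -> \bar R}) (f g h : T -> \bar R) (a b : R) :
  0 <= a -> 0 <= b ->
  (forall x, 0 <= f x)%E -> (forall x, 0 <= g x)%E -> (forall x, 0 <= h x)%E ->
  measurable_fun setT f -> measurable_fun setT g -> measurable_fun setT h ->
  {ae P, forall x, f x <= a%:E * g x + b%:E * h x}%E ->
  (\int[P]_x f x <= a%:E * \int[P]_x g x + b%:E * \int[P]_x h x)%E.
Proof.
move=> a0 b0 f0 g0 h0 mf mg mh fgh.
(* Linearity rests on nonnegativity rather than integrability, so infinite integrals are allowed. *)
rewrite -!ge0_integralZl// -ge0_integralD//; last 4 first.
- by move=> x _; rewrite mule_ge0.
- exact: measurable_funeM.
- by move=> x _; rewrite mule_ge0.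
- exact: measurable_funeM.
apply: ae_ge0_le_integral => //.
- by move=> x _; rewrite adde_ge0 ?mule_ge0.
- by apply: emeasurable_funD; exact: measurable_funeM.
- by apply: filterS fgh => x + _.
Qed.

Lemma integral_ell_le (R : realType) (n m : nat)
    (P : {measure set ('rV[R]_n * 'rV[R]_m) -> \bar R})
    (G : 'rV[R]_m -> 'rV[R]_n) (t : R) (s : 'rV[R]_n * 'rV[R]_m) :
  P setT = 1%E -> Lip G -> 0 < t -> K_dirac s P ->
  (\int[P]_r (ell r G)%:E <=
   (1 + t)%:E * (ell s G)%:E +
   ((1 + t^-1) * lip_const G ^+ 2)%:E * \int[P]_r (cost s r)%:E)%E.
Proof.
move=> P1 GL t0 /K_dirac_ae Ps.
have a0 : 0 <= 1 + t by rewrite addr_ge0// ltW.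
have b0 : 0 <= (1 + t^-1) * lip_const G ^+ 2.
  by rewrite mulr_ge0 ?sqr_ge0// addr_ge0// invr_ge0 ltW.
have mc : measurable_fun setT (fun r => (cost s r)%:E).
  by apply/measurable_EFinP; exact: measurable_cost.
have c0 r : (0 <= (cost s r)%:E)%E by rewrite lee_fin sqr_ge0.
(* Since [P] has mass one, the constant in [r] becomes an integral, and the bound is a linear
   combination of integrals against [P]. *)
have -> : (ell s G)%:E = (\int[P]_r (ell s G)%:E)%E.
  by rewrite integral_cst// P1 mule1.
apply: ae_integral_le_lincomb => //.
- by move=> r; rewrite lee_fin sqr_ge0.
- by move=> r; rewrite lee_fin sqr_ge0.
- by apply/measurable_EFinP; exact: measurable_ell.
- by apply: filterS Ps => r /= rs; rewrite -!EFinM -EFinD lee_fin; exact: ell_le.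
Qed.

Lemma Omega_integral_ell_le (R : realType) (n m : nat)
    (mu : probability ('rV[R]_n * 'rV[R]_m)%type R) (eps : R)
    (k : R.-pker (completion mu) ~> ('rV[R]_n * 'rV[R]_m)%type)
    (G : 'rV[R]_m -> 'rV[R]_n) (t : R) :
  Omega mu (@K_dirac R n m) (@cost R n m) eps k -> Lip G -> 0 < t ->
  (\int[completed mu]_s \int[k s]_r (ell r G)%:E <=
   (1 + t)%:E * \int[mu]_s (ell s G)%:E +
   ((1 + t^-1) * (lip_const G ^+ 2 * eps))%:E)%E.
Proof.
move=> [kK kc] GL t0.
have a0 : 0 <= 1 + t by rewrite addr_ge0// ltW.
have b0 : 0 <= (1 + t^-1) * lip_const G ^+ 2.
  by rewrite mulr_ge0 ?sqr_ge0// addr_ge0// invr_ge0 ltW.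
have e0 s : (0 <= (ell s G)%:E)%E by rewrite lee_fin sqr_ge0.
have me : measurable_fun setT (fun s => (ell s G)%:E).
  by apply/measurable_EFinP; exact: measurable_ell.
have me' : measurable_fun setT (fun s : completion mu => (ell s G)%:E).
  exact: (measurableT_comp me (@measurable_fun_id_completion _ _ _ mu)).
have c0 (s r : 'rV[R]_n * 'rV[R]_m) : (0 <= (cost s r)%:E)%E by rewrite lee_fin sqr_ge0.
have C0 (s : completion mu) : (0 <= \int[k s]_r (cost s r)%:E)%E.
  exact: integral_ge0.
have mC : measurable_fun setT
    (fun s : completion mu => \int[k s]_r (cost s r)%:E)%E.
  apply: (measurable_fun_integral_finite_kernel
    (fun p : completion mu * _ => (cost p.1 p.2)%:E)) => //.
  apply/measurable_EFinP; apply: measurable_cost => //.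
  exact: (measurableT_comp (@measurable_fun_id_completion _ _ _ mu)
    measurable_fst).
rewrite mulrA EFinM.
(* The budget constraint of [Omega] replaces the double integral of the cost by [eps]. *)
apply: (@le_trans _ _ ((1 + t)%:E * \int[mu]_s (ell s G)%:E +
   ((1 + t^-1) * lip_const G ^+ 2)%:E *
     \int[completed mu]_s \int[k s]_r (cost s r)%:E)%E); last first.
  by rewrite leeD2l// lee_wpmul2l.
rewrite -(integral_completed _ e0 me).
apply: (@ae_integral_le_lincomb _ (completion mu) R (completed mu)
  (fun s => \int[k s]_r (ell r G)%:E)%E (fun s => (ell s G)%:E)
  (fun s => \int[k s]_r (cost s r)%:E)%E _ _ a0 b0 _ e0 C0 _ me' mC).
- by move=> s; exact: integral_ge0.
- apply: (measurable_fun_integral_finite_kernel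
    (fun p : completion mu * _ => (ell p.2 G)%:E)) => //.
  exact: (measurableT_comp me measurable_snd).
(* The inequality can only fail where [k s] lies outside [K_dirac s], which is a null set. *)
apply: negligibleS kK => s /=; apply: contra_not => kKs.
by apply: integral_ell_le => //; exact: prob_kernel.
Qed.

(** * Optimisation over [t] and conclusion *)

Lemma sqr_sqrteD_ge (R : realType) (x A : \bar R) (b : R) :
  (0 <= A)%E -> 0 <= b ->
  (forall t : R, (0 < t)%R -> x <= (1 + t)%:E * A + ((1 + t^-1) * b ^+ 2)%:E)%E ->
  (x <= (sqrte A + b%:E) ^+ 2)%E.
Proof.
(* If [A] is infinite, so is the right side. *)
case: A => [a| |//]; last first.
  by move=> *; rewrite [sqrte _]/= addye// expe2 mulyy leey.
rewrite lee_fin => a0 b0 xab; apply/lee_addgt0Pr => e e0.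
rewrite [X in (_ <= X + _)%E](_ : _ = ((Num.sqrt a + b) ^+ 2)%:E); last first.
  by rewrite EFin_expe.
pose s := Num.sqrt a; have s0 : 0 <= s by exact: sqrtr_ge0.
have aE : a = s ^+ 2 by rewrite sqr_sqrtr.
rewrite -/s; clearbody s.
have [t t0 ht] : exists2 t, 0 < t & t * a + t^-1 * b ^+ 2 <= 2 * s * b + e.
  (* The minimiser t = b / s is degenerate when s = 0 or b = 0, where it only
     exists in the limit: hence the slack e. *)
  have [/eqP s00|sN0] := boolP (s == 0).
    (* Here $a=0$ and $b^2/t = e\,b^2/(b^2+1) \le e$; the added 1 keeps [t] positive when $b=0$. *)
    exists ((b ^+ 2 + 1) / e); first by rewrite divr_gt0// ltr_wpDl ?sqr_ge0.
    rewrite aE s00 expr0n/= !(mulr0, mul0r, add0r) invf_div.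
    rewrite mulrAC ler_pdivrMr ?ltr_wpDl ?sqr_ge0//.
    by rewrite ler_wpM2l ?(ltW e0)// lerDl.
  have [/eqP b00|bN0] := boolP (b == 0).
    (* Here $b=0$ and $ta=e$ uses up exactly the slack. *)
    exists (e / a).
      by rewrite divr_gt0// aE exprn_gt0// lt_neqAle eq_sym sN0.
    by rewrite b00 expr0n/= !mulr0 !addr0 add0r divfK// aE expf_neq0.
  have {}s0 : 0 < s by rewrite lt_neqAle eq_sym sN0.
  have {}b0 : 0 < b by rewrite lt_neqAle eq_sym bN0.
  (* At this [t] both terms equal $sb$, the equality case of the arithmetic-geometric mean
     inequality. *)
  exists (b / s); first by rewrite divr_gt0.
  rewrite aE [leLHS](_ : _ = 2 * s * b) ?lerDl ?ltW//.
  by field; rewrite bN0 sN0.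
apply: le_trans (xab t t0) _; rewrite -EFinM -EFinD lee_fin.
by rewrite sqrrD -aE; lra.
Qed.

Theorem theorem4p2 (R : realType) (n m : nat)
    (mu : probability ('rV[R]_n * 'rV[R]_m)%type R) (eps : R) (heps : 0 <= eps) :
  (ereal_inf [set I_Omega mu (@K_dirac R n m) (@cost R n m) eps (@ell R n m) G
             | G in @Lip R m n]
   <= ereal_inf [set (sqrte (\int[mu]_s (enorm (G s.2 - s.1) ^+ 2)%:E)
                      + (lip_const G * Num.sqrt eps)%:E) ^+ 2
                | G in @Lip R m n])%E.
Proof.
apply: le_ereal_inf_tmp => _ [G GL <-].
apply: ge_ereal_inf; eexists; first by exists G.
apply: ge_ereal_sup => _ [k kO <-].
apply: sqr_sqrteD_ge => [||t t0].
- by apply: integral_ge0 => s _; rewrite lee_fin sqr_ge0.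
- by rewrite mulr_ge0 ?lip_const_ge0 ?sqrtr_ge0.
(* With $b = L\sqrt{\varepsilon}$, [heps] gives $b^2 = L^2\varepsilon$, the form of the integrated
   bound. *)
- rewrite exprMn sqr_sqrtr//; exact: Omega_integral_ell_le.
Qed.
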